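(* Let $I\subset[0,\infty)$ be an interval with interior $I^{\circ}$, and let $f:I\to\mathbb{R}$ be a twice differentiable function on $I^{\circ}$ such that $f''\in L_1[a,b]$, where $a,b\in I$ with $a<b$. If $|f''|$ is $s$-convex in the second sense on $[a,b]$ for some fixed $s\in(0,1]$, then for each $x\in[a,b]$ $$\left|\frac{1}{b-a}\int_a^b f(u)\,du-f(x)+\left(x-\frac{a+b}{2}\right)f'(x)\right|\le\frac{1}{2(b-a)}\left\{\left[\frac{|f''(x)|}{s+3}+\frac{2|f''(a)|}{(s+1)(s+2)(s+3)}\right](x-a)^3+\left[\frac{|f''(x)|}{s+3}+\frac{2|f''(b)|}{(s+1)(s+2)(s+3)}\right](b-x)^3\right\}.$$
   Context: For fixed $s\in(0,1]$, a real-valued function $g$ is $s$-convex in the second sense on $[a,b]\subset[0,\infty)$ if $g(ty+(1-t)z)\le t^s g(y)+(1-t)^s g(z)$ for all $y,z\in[a,b]$ and $t\in[0,1]$. $L_1[a,b]$ denotes the Lebesgue integrable functions on $[a,b]$. *)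

(* Defs.v *)
From HB Require Import structures.
From mathcomp Require Import all_boot all_order all_algebra.
From mathcomp Require Import all_classical all_reals all_analysis.
Set Implicit Arguments. Unset Strict Implicit. Unset Printing Implicit Defensive.
Import Order.TTheory GRing.Theory Num.Theory.
Import numFieldNormedType.Exports.
Local Open Scope classical_set_scope.
Local Open Scope ring_scope.

(* Increments h != 0 tending to 0 with x + h in I: two-sided when x is interior
   to I, one-sided when x is an endpoint of I belonging to I. *)
Definition incr_within (R : realType) (I : set R) (x : R) : set_system R :=
  within [set h | I (h + x)] 0^'.

Definition derivable_within (R : realType) (I : set R) (f : R -> R) (x : R) :
    Prop :=
  cvg ((fun h => h^-1 *: (f (h + x) - f x)) @ incr_within I x).

Definition derive_within (R : realType) (I : set R) (f : R -> R) (x : R) : R :=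
  lim ((fun h => h^-1 *: (f (h + x) - f x)) @ incr_within I x).

Lemma incr_within_interior (R : realType) (I : set R) (x : R) :
  interior I x -> incr_within I x = 0^'.
Proof.
move=> Ix; have nI : \forall h \near 0^', I (h + x).
  apply: nbhs_dnbhs.
  have /(_ (0 : R)) c : continuous (fun h : R => h + x).
    by move=> h; apply: cvgD; [exact: cvg_id|exact: cvg_cst].
  by apply: (c I); rewrite add0r.
apply/seteqP; split => A; rewrite /incr_within /within /=; last first.
  by apply: filterS => h Ah _.
by move=> H; apply: filterS2 nI H => h Ih; exact.
Qed.

Lemma derivable_within_interior (R : realType) (I : set R) (f : R -> R) (x : R) :
  interior I x -> derivable_within I f x <-> derivable f x 1.
Proof.
move=> Ix; rewrite /derivable_within /derivable incr_within_interior //.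
have -> : (fun h : R => h^-1 *: (f (h + x) - f x)) =
          (fun h : R => h^-1 *: ((f \o shift x) (h *: (1 : R)) - f x)).
  by apply/funext => h /=; rewrite [h *: _]mulr1.
by [].
Qed.

Lemma derive_within_interior (R : realType) (I : set R) (f : R -> R) (x : R) :
  interior I x -> derive_within I f x = derive1 f x.
Proof. by move=> Ix; rewrite /derive_within incr_within_interior. Qed.

(* s-convexity in the second sense on [a, b]; note 0 `^ s = 0 for s > 0. *)
Definition s_convex2 (R : realType) (s a b : R) (g : R -> R) : Prop :=
  forall y z t, a <= y <= b -> a <= z <= b -> 0 <= t <= 1 ->
    g (t * y + (1 - t) * z) <= t `^ s * g y + (1 - t) `^ s * g z.

(* Main.v *)
(* Along the segment y(t) = c + t w from c to x, with w = x - c and F a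
   primitive of f, the function
     H(t) = w^2 t^2 f'(y(t)) - 2 w t f(y(t)) + 2 F(y(t))
   has derivative w^3 t^2 f''(y(t)): this replaces two integrations by parts
   and needs no integral of f''. By s-convexity H' is dominated by
   |w|^3 t^2 (t^s |f''(x)| + (1 - t)^s |f''(c)|), which has an explicit
   primitive, so the mean value theorem bounds H(1) - H(0). Taking c = a and
   c = b and subtracting gives 2 (b - a) times the quantity to be estimated. *)
Require Import Defs.
From mathcomp Require Import all_boot all_order all_algebra.
From mathcomp Require Import all_classical all_reals all_analysis.
From mathcomp Require Import ring lra.
Set Implicit Arguments. Unset Strict Implicit. Unset Printing Implicit Defensive.
Import Order.TTheory GRing.Theory Num.Theory.
Import numFieldNormedType.Exports.
Local Open Scope classical_set_scope.
Local Open Scope ring_scope.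

Lemma within_continuous_comp (T U V : topologicalType) (A : set T) (B : set U)
    (g : T -> U) (f : U -> V) :
  continuous g -> (forall x, A x -> B (g x)) ->
  {within B, continuous f} -> {within A, continuous (f \o g)}.
Proof.
move=> cg AB /subspace_continuousP cf; apply/subspace_continuousP => x Ax.
apply: cvg_trans (cf _ (AB _ Ax)) => W WB.
have := cg x _ WB; rewrite /within /= !nbhs_simpl /=.
by apply: filterS => t Ht At; apply: Ht (AB _ At).
Qed.

Lemma within_continuous_powR (R : realType) (p : R) : 0 < p ->
  {within `[0, 1], continuous (fun t : R => t `^ p)}.
Proof.
move=> p0; have cp (t : R) : 0 < t -> {for t, continuous (fun t : R => t `^ p)}.
  move=> t0; apply: differentiable_continuous; apply/derivable1_diffP.
  by apply: derivable_powR; rewrite in_itv/= t0.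
apply/continuous_within_itvP => //; split.
- by move=> t; rewrite in_itv/= => /andP[t0 _]; exact: cp.
- by rewrite powR0 ?gt_eqF//; exact: powR_cvg0.
- exact/cvg_at_left_filter/cp.
Qed.

(** The mean value theorem is applied to [v - u] and to [v + u]: both derivatives are nonnegative as
    soon as [|u'| <= v'], and the two resulting inequalities are the two sides of the absolute
    value. *)
Lemma dominated_increment (R : realType) (u v u' v' : R -> R) (a b : R) :
  a <= b -> {within `[a, b], continuous u} -> {within `[a, b], continuous v} ->
  (forall t, t \in `]a, b[ -> is_derive t 1 u (u' t)) ->
  (forall t, t \in `]a, b[ -> is_derive t 1 v (v' t)) ->
  (forall t, t \in `]a, b[ -> `|u' t| <= v' t) ->
  `|u b - u a| <= v b - v a.
Proof.
rewrite le_eqVlt => /predU1P[<-|ab cu cv du dv uv].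
  by rewrite !subrr normr0.
have [c cab Ec] : exists2 c, c \in `]a, b[ &
    v b - u b - (v a - u a) = (v' c - u' c) * (b - a).
  by have [c] := MVT ab (fun t ht => is_deriveB (dv t ht) (du t ht))
    (within_continuousB cv cu); exists c.
have [d dab Ed] : exists2 d, d \in `]a, b[ &
    v b + u b - (v a + u a) = (v' d + u' d) * (b - a).
  by have [d] := MVT ab (fun t ht => is_deriveD (dv t ht) (du t ht))
    (within_continuousD cv cu); exists d.
have ba : 0 <= b - a by rewrite subr_ge0 ltW.
have hc : 0 <= (v' c - u' c) * (b - a).
  by rewrite mulr_ge0// subr_ge0; apply: le_trans (uv c cab); exact: ler_norm.
have hd : 0 <= (v' d + u' d) * (b - a).
  rewrite mulr_ge0// -[u' d]opprK subr_ge0; apply: le_trans (uv d dab).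
  by rewrite -normrN ler_norm.
by rewrite ler_norml; apply/andP; split; lra.
Qed.

Lemma is_derive_affine (R : realType) (g : R -> R) (c w t dg : R) :
  is_derive (c + t * w) 1 g dg ->
  is_derive t 1 (fun t => g (c + t * w)) (w * dg).
Proof.
move=> dgy.
have dy : is_derive t 1 (fun t => c + t * w) w.
  by apply: is_derive_eq; rewrite add0r mul1r scaler0 add0r; exact: mulr1.
have := @is_derive1_comp _ g (fun t => c + t * w) t dg w dgy dy.
by rewrite mulrC.
Qed.

Lemma is_derive_powR1 (R : realType) (p t : R) : 0 < t ->
  is_derive t 1 (fun t => t `^ (p + 1)) ((p + 1) * t `^ p).
Proof.
move=> t0; have := is_derive1_powR (p + 1) t0.
by rewrite addrK.
Qed.

(** The estimate on a single segment from [c] to [x]. The two constants are the integrals over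
    [0, 1] of t^(s+2) and of t^2 (1-t)^s, the latter being the Beta value B(3, s+1). Derivatives are
    asked for only inside the interval, so [c] may be an endpoint. *)
Lemma taylor_integral_bound (R : realType) (F f f' f'' : R -> R)
    (a b c x s P Q : R) :
  0 < s ->
  {within `[a, b], continuous F} ->
  {within `[a, b], continuous f} ->
  {within `[a, b], continuous f'} ->
  (forall y, y \in `]a, b[ -> is_derive y 1 F (f y)) ->
  (forall y, y \in `]a, b[ -> is_derive y 1 f (f' y)) ->
  (forall y, y \in `]a, b[ -> is_derive y 1 f' (f'' y)) ->
  a <= c <= b -> a <= x <= b ->
  (forall t, 0 <= t <= 1 ->
    `|f'' (t * x + (1 - t) * c)| <= t `^ s * P + (1 - t) `^ s * Q) ->
  `|(x - c) ^+ 2 * f' x - 2 * (x - c) * f x + 2 * (F x - F c)| <=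
  `|x - c| ^+ 3 * (P / (s + 3) + 2 * Q / ((s + 1) * (s + 2) * (s + 3))).
Proof.
move=> s0 cF cf cf' dF df df' /andP[ac cb] /andP[ax xb] bnd.
(* The degenerate segment is set aside because it could sit at an endpoint; for [x != c] the open
   segment lies strictly inside []a, b[]. *)
have [->|xc] := eqVneq x c.
  by rewrite !subrr !normr0 !expr0n/= !(mulr0, mul0r, subrr, addr0) normr0.
set w := x - c; set y := fun t : R => c + t * w.
have yE t : y t = t * x + (1 - t) * c by rewrite /y /w; ring.
have cy : continuous y.
  move=> t; apply: cvgD; first exact: cvg_cst.
  by apply: cvgM; [exact: cvg_id|exact: cvg_cst].
have yab (t : R) : t \in `[0, 1] -> y t \in `[a, b].
  by rewrite !in_itv/= yE => /andP[t0 t1]; apply/andP; split; nra.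
have yab' (t : R) : t \in `]0, 1[ -> y t \in `]a, b[.
  rewrite !in_itv/= yE => /andP[t0 t1].
  by have [xc'|xc'|xc'] := ltgtP x c; [| |by rewrite xc' eqxx in xc];
    apply/andP; split; nra.
have comp (g : R -> R) : {within `[a, b], continuous g} ->
    {within `[0, 1], continuous (g \o y)}.
  move=> cg; apply: (@within_continuous_comp R R R _ `[a, b] y g cy _ cg) => t.
  exact: yab.
pose H t := w ^+ 2 * t ^+ 2 * f' (y t) - 2 * w * t * f (y t) + 2 * F (y t).
(* [B] is the primitive of t^2 (1-t)^s obtained by writing t^2 = 1 - 2(1-t) + (1-t)^2 and
   integrating term by term. *)
pose B t := 2 / (s + 2) * (1 - t) `^ (s + 2) - (s + 1)^-1 * (1 - t) `^ (s + 1)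
  - (s + 3)^-1 * (1 - t) `^ (s + 3).
pose V t := `|w| ^+ 3 * (P / (s + 3) * t `^ (s + 3) + Q * B t).
(* At [t = 0] and [t = 1] the point [y t] may be an endpoint, so only continuity relative to
   [[a, b]] is available; it is transported through [y]. *)
have cH : {within `[0, 1], continuous H}.
  move=> t; apply: cvgD; [apply: cvgB|]; apply: cvgM.
  - apply: (continuous_subspaceT (f := fun t : R => w ^+ 2 * t ^+ 2)) => u.
    by apply: cvgM; [exact: cvg_cst|exact: exprn_continuous].
  - exact: (comp f').
  - apply: (continuous_subspaceT (f := fun t : R => 2 * w * t)) => u.
    by apply: cvgM; [exact: cvg_cst|exact: cvg_id].
  - exact: (comp f).
  - exact: cvg_cst.
  - exact: (comp F).
have cpw p : 0 < p -> {within `[0, 1], continuous (fun t : R => (1 - t) `^ p)}.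
  move=> p0; apply: (@within_continuous_comp R R R _ `[0, 1] (fun t : R => 1 - t)
    (fun t => t `^ p)) => [t|t|].
  - by apply: cvgB; [exact: cvg_cst|exact: cvg_id].
  - by rewrite /= !in_itv/= => /andP[? ?]; apply/andP; split; lra.
  - exact: within_continuous_powR.
have cV : {within `[0, 1], continuous V}.
  move=> t; apply: cvgM; first exact: cvg_cst.
  apply: cvgD; apply: cvgM; try exact: cvg_cst.
    by apply: within_continuous_powR; lra.
  apply: cvgB; [apply: cvgB|]; apply: cvgM; try exact: cvg_cst.
  - by apply: cpw; lra.
  - by apply: cpw; lra.
  - by apply: cpw; lra.
have dH (t : R) : t \in `]0, 1[ -> is_derive t 1 H (w ^+ 3 * t ^+ 2 * f'' (y t)).
  move=> /yab' yt.
  have dFy := is_derive_affine (dF _ yt).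
  have dfy := is_derive_affine (df _ yt).
  have df'y := is_derive_affine (df' _ yt).
  (* The product rule produces terms in [f'] and in [f] that cancel in pairs, leaving only the one
     in [f'']. *)
  by apply: is_derive_eq; rewrite /GRing.scale/=; ring.
have dV (t : R) : t \in `]0, 1[ -> is_derive t 1 V
    (`|w| ^+ 3 * t ^+ 2 * (t `^ s * P + (1 - t) `^ s * Q)).
  rewrite in_itv/= => /andP[t0 t1]; have t1' : 0 < 1 - t by rewrite subr_gt0.
  have s1 : s + 1 != 0 by lra.
  have s2 : s + 2 != 0 by lra.
  have s3 : s + 3 != 0 by lra.
  have E1 : s + 1 + 1 = s + 2 by ring.
  have E2 : s + 2 + 1 = s + 3 by ring.
  have pw p : is_derive t 1 (fun t : R => (1 - t) `^ (p + 1))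
      (- 1 * ((p + 1) * (1 - t) `^ p)).
    have := @is_derive_affine _ (fun t => t `^ (p + 1)) 1 (-1) t.
    rewrite mulrN1 => /(_ _ (is_derive_powR1 p t1')).
    by under eq_fun do rewrite mulrN1.
  have p1 := pw s.
  have := pw (s + 1); rewrite E1 => p2.
  have := pw (s + 2); rewrite E2 => p3.
  have := is_derive_powR1 (s + 2) t0; rewrite E2 => q3.
  have powS (r : R) n : 0 < r -> r `^ (s + n%:R) = r `^ s * r ^+ n.
    by move=> r0; rewrite powRD ?powR_mulrn ?ltW// (gt_eqF r0) implybT.
  apply: is_derive_eq; rewrite /GRing.scale/=.
  (* Every power is split as r^s times a natural power, so that [field] sees only t^s and (1-t)^s as
     atoms; the exponent [s + 1] is treated apart since [1] is not written as [n%:R]. *)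
  rewrite !powS//  (powS _ 1%N)//.
  by field; rewrite s1 s2 s3.
have dom (t : R) : t \in `]0, 1[ ->
    `|w ^+ 3 * t ^+ 2 * f'' (y t)| <=
    `|w| ^+ 3 * t ^+ 2 * (t `^ s * P + (1 - t) `^ s * Q).
  rewrite in_itv/= => /andP[t0 t1].
  have -> : `|w ^+ 3 * t ^+ 2 * f'' (y t)| = `|w| ^+ 3 * t ^+ 2 * `|f'' (y t)|.
    by rewrite normrM normrM (normrX 3) (normrX 2) (ger0_norm (ltW t0)).
  rewrite yE ler_wpM2l//.
    by rewrite mulr_ge0 ?exprn_ge0// ltW.
  by apply: bnd; rewrite !ltW.
have := dominated_increment ler01 cH cV dH dV dom.
have y0 : y 0 = c by rewrite /y mul0r addr0.
have y1 : y 1 = x by rewrite /y /w; ring.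
have -> : H 1 - H 0 = w ^+ 2 * f' x - 2 * w * f x + 2 * (F x - F c).
  by rewrite /H y0 y1; ring.
have -> // : V 1 - V 0 =
    `|w| ^+ 3 * (P / (s + 3) + 2 * Q / ((s + 1) * (s + 2) * (s + 3))).
have s1 : s + 1 != 0 by lra.
have s2 : s + 2 != 0 by lra.
have s3 : s + 3 != 0 by lra.
rewrite /V /B subrr subr0 !powR1 !powR0//.
by field; rewrite s1 s2 s3.
Qed.

(** The increment of [f] is [h] times the difference quotient, hence tends to [0 * l]. *)
Lemma derivable_within_cvg (R : realType) (I : set R) (f : R -> R) (x : R) :
  derivable_within I f x -> f @ within I (nbhs x) --> f x.
Proof.
move=> /cvg_ex[l fl]; apply/cvgrPdist_lt => e e0.
have cF : (fun h : R => h * (h^-1 *: (f (h + x) - f x))) @ incr_within I x --> (0 : R).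
  rewrite -(mul0r l); apply: cvgM; last exact: fl.
  by apply: cvg_within_filter; exact: cvg_within.
have {cF} : \forall h \near (0 : R), h != 0 -> I (h + x) ->
    `|0 - h * (h^-1 *: (f (h + x) - f x))| < e.
  by move/cvgrPdist_lt : cF => /(_ _ e0).
have sub : (fun y : R => y - x) @ x --> (0 : R).
  by rewrite -(subrr x); apply: cvgB; [exact: cvg_id|exact: cvg_cst].
move=> /sub; rewrite /within /= !nbhs_simpl /=; apply: filterS => y.
rewrite /= subrK sub0r normrN => + Iy.
(* The punctured filter says nothing at [y = x], where the difference is zero anyway. *)
have [-> _|yx] := eqVneq y x; first by rewrite subrr normr0.
rewrite subr_eq0 yx => /(_ isT Iy).
by rewrite /GRing.scale/= mulVKf ?subr_eq0// distrC.
Qed.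

Lemma is_derive_within (R : realType) (I : set R) (f : R -> R) (x : R) :
  interior I x -> derivable f x 1 -> is_derive x 1 f (derive_within I f x).
Proof.
by move=> Ix df; rewrite derive_within_interior// derive1E; exact: derivableP.
Qed.

(** The interior is open, so both derivative functions agree near [x], and derivability is local. *)
Lemma derivable_derive_within (R : realType) (I : set R) (f : R -> R) (x : R) :
  interior I x -> derivable (derive1 f) x 1 ->
  derivable (derive_within I f) x 1.
Proof.
move=> Ix; apply: near_eq_derivable.
move/nbhs_interior : Ix; apply: filterS => y Iy.
by rewrite derive_within_interior.
Qed.

Theorem theorem4 (R : realType) (I : set R) (f : R -> R) (a b s : R) :
  let f' := derive_within I f in
  let f'' := derive_within I f' in
  is_interval I -> I `<=` `[0, +oo[ ->
  I a -> I b -> a < b -> 0 < s -> s <= 1 ->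
  (forall x, interior I x -> derivable f x 1 /\ derivable (derive1 f) x 1) ->
  (forall x, x = a \/ x = b ->
    derivable_within I f x /\ derivable_within I f' x) ->
  lebesgue_measure.-integrable `[a, b] (EFin \o f'') ->
  s_convex2 s a b (fun y => `|f'' y|) ->
  forall x, a <= x <= b ->
  `| (b - a)^-1 * (\int[lebesgue_measure]_(u in `[a, b]) f u) - f x
     + (x - (a + b) / 2) * f' x |
  <= (2 * (b - a))^-1 *
     ((`|f'' x| / (s + 3) + 2 * `|f'' a| / ((s + 1) * (s + 2) * (s + 3)))
        * (x - a) ^+ 3
      + (`|f'' x| / (s + 3) + 2 * `|f'' b| / ((s + 1) * (s + 2) * (s + 3)))
        * (b - x) ^+ 3).
Proof.
move=> f' f'' itvI _ Ia Ib ab s0 _ dI dab _ cvx x axb.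
have subI y : a <= y <= b -> I y by exact: itvI.
have subab : `[a, b] `<=` I by move=> y; rewrite /= in_itv/=; exact: subI.
have intI y : y \in `]a, b[ -> interior I y.
  move=> yab; apply: (interiorS subab); rewrite interior_itv_bnd.
  exact: yab.
have df y : y \in `]a, b[ -> is_derive y 1 f (f' y).
  by move=> /intI Iy; apply: is_derive_within => //; have [] := dI _ Iy.
have df' y : y \in `]a, b[ -> is_derive y 1 f' (f'' y).
  move=> /intI Iy; apply: is_derive_within => //.
  by apply: derivable_derive_within => //; have [] := dI _ Iy.
(* [a] and [b] may be endpoints of [I]; there the separate hypothesis is used, elsewhere the
   two-sided derivatives. *)
have dw y : a <= y <= b -> derivable_within I f y /\ derivable_within I f' y.
  move=> /andP[ay yb].
  have [->|ya] := eqVneq y a; first by apply: dab; left.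
  have [->|yb'] := eqVneq y b; first by apply: dab; right.
  have yab : y \in `]a, b[ by rewrite in_itv/= !lt_neqAle ay yb yb' eq_sym ya.
  by split; apply/(derivable_within_interior _ (intI _ yab));
    [case: (df _ yab)|case: (df' _ yab)].
have cont g : (forall y, a <= y <= b -> derivable_within I g y) ->
    {within `[a, b], continuous g}.
  move=> dg; apply/subspace_continuousP => y; rewrite /= in_itv/= => yab.
  apply: cvg_trans (derivable_within_cvg (dg _ yab)).
  by apply: cvg_app; apply: within_subset.
have cf : {within `[a, b], continuous f} by apply: cont => y /dw[].
have cf' : {within `[a, b], continuous f'} by apply: cont => y /dw[].
have intf : lebesgue_measure.-integrable `[a, b] (EFin \o f).
  exact: continuous_compact_integrable (@segment_compact _ a b) cf.
(* The primitive vanishing at [a], so that [F b] is the integral in the statement. *)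
pose F u := \int[lebesgue_measure]_(t in `[a, u]) f t.
have cF : {within `[a, b], continuous F}.
  exact: parameterized_integral_continuous (ltW ab) intf.
have dF y : y \in `]a, b[ -> is_derive y 1 F (f y).
  move=> yab; have cfy := within_continuous_continuous ab cf yab.
  move: yab; rewrite in_itv/= => /andP[ay yb].
  have [dFy <-] := continuous_FTC1_closed yb intf ay cfy.
  by rewrite derive1E; exact: derivableP.
have Fa : F a = 0 by rewrite /F set_itv1 Rintegral_set1.
have acc : a <= a <= b by rewrite lexx ltW.
have bcc : a <= b <= b by rewrite lexx ltW.
have bnd c : a <= c <= b ->
    `|(x - c) ^+ 2 * f' x - 2 * (x - c) * f x + 2 * (F x - F c)| <=
    `|x - c| ^+ 3 *
    (`|f'' x| / (s + 3) + 2 * `|f'' c| / ((s + 1) * (s + 2) * (s + 3))).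
  move=> cab; apply: (taylor_integral_bound s0 cF cf cf' dF df df' cab axb).
  by move=> t t01; exact: cvx.
have /andP[ax xb] := axb.
have := bnd b bcc; have := bnd a acc; rewrite Fa subr0 => bnda bndb.
rewrite -/(F b) (ger0_norm (_ : 0 <= x - a)) ?subr_ge0// in bnda *.
rewrite (distrC x b) (ger0_norm (_ : 0 <= b - x)) ?subr_ge0// in bndb.
(* In [A - B] the factor of [f' x] is (x-a)^2 - (x-b)^2 = 2(b-a)(x - (a+b)/2), that of [f x] is
   -2(b-a), and [F x] drops out, leaving [2 * F b]. *)
set A := _ + 2 * F x in bnda; set B := _ + 2 * (F x - F b) in bndb.
have -> : (b - a)^-1 * F b - f x + (x - (a + b) / 2) * f' x =
    (2 * (b - a))^-1 * (A - B).
  have ba : b - a != 0 by rewrite subr_eq0 gt_eqF.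
  by rewrite /A /B; field.
have ba0 : 0 <= (2 * (b - a))^-1 by rewrite invr_ge0 mulr_ge0// subr_ge0 ltW.
rewrite normrM (ger0_norm ba0) ler_wpM2l// (le_trans (ler_normB _ _))//.
by rewrite lerD// mulrC.
Qed.
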